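(* Let $d$ be a positive integer. By specializing $q$ to $0$, one obtains an isomorphism of $\mathbb{Q}$-algebras $$\mathbb{A}^d_q(\Lambda)|_{q=0}\cong\mathbb{A}^d(\Lambda).$$
   Context: $\mathbb{N}=\{0,1,2,\ldots\}$, $q$ is an indeterminate, and $d$ is a fixed positive integer. Partitions: a partition of length $n$ is a vector $\lambda\in\mathbb{N}^n$ with $\lambda_1\le\cdots\le\lambda_n$ (zero entries allowed). $\Lambda_n$ is the set of partitions of length $n$, and $\Lambda=\bigsqcup_{n\ge0}\Lambda_n$. For $\mu\in\mathbb{N}^n$, $\mu_{\le}\in\Lambda_n$ is the increasing rearrangement of $\mu$. Reineke's algebra $\mathbb{A}^d(\Lambda)$: it is the $\mathbb{Q}$-vector space with basis $\Lambda$ and bilinear multiplication $$\mu\ast\nu=(\mu_1,\ldots,\mu_m,\nu_1+m(d-1),\ldots,\nu_n+m(d-1))_{\le}\qquad(\mu\in\Lambda_m,\ \nu\in\Lambda_n).$$ The coefficients: for positive integers $m,n$, the elements $c_{m,n}^{\mathbf a,\mathbf b}\in\mathbb{Q}[q]$ ($\mathbf a\in\mathbb{N}^m$, $\mathbf b\in\mathbb{N}^n$) are defined by $$\prod_{s=m+1}^{m+n}\prod_{t=1}^m(x_s-qx_t)^{d-1}=\sum_{\mathbf a\in\mathbb{N}^m,\ \mathbf b\in\mathbb{N}^n}c_{m,n}^{\mathbf a,\mathbf b}\,x_1^{a_1}\cdots x_m^{a_m}x_{m+1}^{b_1}\cdots x_{m+n}^{b_n}.$$ The algebra $\mathbb{A}^d_q(\hat\Lambda)$: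 let $\hat\Lambda=\bigsqcup_{n\ge0}\mathbb{N}^n$, with $\emptyset$ the unique element of $\mathbb{N}^0$. $\mathbb{A}^d_q(\hat\Lambda)$ is the free $\mathbb{Q}[q]$-module with basis $\hat\Lambda$, with $\mathbb{Q}[q]$-bilinear multiplication for which $\emptyset$ is the unit and, for $\mu\in\mathbb{N}^m$, $\nu\in\mathbb{N}^n$ with $m,n\ge1$, $\mu\ast\nu=\sum_{\mathbf a,\mathbf b}c_{m,n}^{\mathbf a,\mathbf b}(\mu+\mathbf a,\nu+\mathbf b)$, where $(\cdot,\cdot)$ denotes concatenation. This is an associative algebra. The algebra $\mathbb{A}^d_q(\Lambda)$: it is the quotient of $\mathbb{A}^d_q(\hat\Lambda)$ by the two-sided ideal generated by all differences (taken in the module $\mathbb{A}^d_q(\hat\Lambda)$) of basis elements $\mu,\nu\in\hat\Lambda$ such that $\mu$ is a permutation of $\nu$. It is a free $\mathbb{Q}[q]$-module with basis $\Lambda$ (each partition being identified with its class), with unit $\emptyset$ and, for $\mu\in\Lambda_m$, $\nu\in\Lambda_n$, $m,n\ge1$, $\mu\ast\nu=\sum_{\mathbf a,\mathbf b}c_{m,n}^{\mathbf a,\mathbf b}(\mu+\mathbf a,\nu+\mathbf b)_{\le}$. Specialization: $\mathbb{A}^d_q(\Lambda)|_{q=0}$ is the $\mathbb{Q}$-algebra $\mathbb{Q}\otimes_{\mathbb{Q}[q]}\mathbb{A}^d_q(\Lambda)$, where $q$ acts on $\mathbb{Q}$ by $0$; that is, the structure constants $c_{m,n}^{\mathbf a,\mathbf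 b}$ are evaluated at $q=0$. *)

(* Defs.v *)
From HB Require Import structures.
From mathcomp Require Import all_boot all_algebra.
From mathcomp Require Import boolp.
From mathcomp Require Import freeg mpoly.

Set Implicit Arguments.
Unset Strict Implicit.
Unset Printing Implicit Defensive.

Import GRing.Theory.
Local Open Scope ring_scope.
Local Open Scope quotient_scope.

Section Fglift.
Context (R : nzRingType) (K : choiceType).
Implicit Types (M : lmodType R) (D : {freeg K / R}).

HB.instance Definition _ M (f : K -> M) :=
  GRing.isZmodMorphism.Build {freeg K / R} M (fglift f) (lift_is_additive f).

Lemma fgliftE M (f : K -> M) D :
  fglift f D = \sum_(k <- dom D) coeff k D *: f k.
Proof.
rewrite -[in LHS](freeg_sumE D) (raddf_sum (fglift f)).
by apply: eq_bigr => k _; rewrite /= liftU.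
Qed.

Lemma scale_freegU (c a : R) k :
  c *: << a *g k >> = << c * a *g k >> :> {freeg K / R}.
Proof. by apply/eqP/freeg_eqP => y; rewrite coeffZ !coeffU mulrA. Qed.

Lemma fglift_is_scalable M (f : K -> M) : scalable (fglift f).
Proof.
move=> c D; rewrite -[in LHS](freeg_sumE D) scaler_sumr raddf_sum.
rewrite fgliftE scaler_sumr; apply: eq_bigr => k _ /=.
by rewrite scale_freegU liftU scalerA.
Qed.

HB.instance Definition _ M (f : K -> M) :=
  GRing.isScalable.Build R {freeg K / R} M *:%R (fglift f)
    (fglift_is_scalable f).

Lemma fgliftU1 M (f : K -> M) k : fglift f << k >> = f k.
Proof. by rewrite liftU scale1r. Qed.

Lemma freeg_linP M (f g : {freeg K / R} -> M) :
  linear f -> linear g -> (forall k, f << k >> = g << k >>) -> f =1 g.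
Proof.
move=> fL gL fg D.
have sumE (h : {freeg K / R} -> M) : linear h ->
    h D = \sum_(k <- dom D) coeff k D *: h << k >>.
  move=> hL; pose hh := GRing.isLinear.Build R _ _ _ h hL.
  pose H : {linear {freeg K / R} -> M} := HB.pack h hh.
  rewrite -[in LHS](freeg_sumE D) -[h]/(H : _ -> _) linear_sum.
  apply: eq_bigr => k _.
  by rewrite -linearZ /= scale_freegU mulr1.
by rewrite (sumE f) // (sumE g) //; apply: eq_bigr => k _; rewrite fg.
Qed.

Lemma fglift_eq M (f g : K -> M) D : f =1 g -> fglift f D = fglift g D.
Proof. by move=> fg; rewrite !fgliftE; apply: eq_bigr => k _; rewrite fg. Qed.

End Fglift.

Lemma fglift_linear_fun (R : comNzRingType) (K1 K2 : choiceType)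
  (M : lmodType R) (f : K1 -> K2 -> M) (D : {freeg K1 / R}) :
  linear (fun E : {freeg K2 / R} => fglift (fun k => fglift (f k) E) D).
Proof.
move=> c x y /=; rewrite !fgliftE scaler_sumr -big_split; apply: eq_bigr => k _ /=.
by rewrite linearP scalerDr !scalerA mulrC.
Qed.

Section StructureAlgebra.
Context (R : comNzRingType) (K : choiceType).

Record structure_law := StructureLaw {
  sl_mul : K -> K -> {freeg K / R};
  sl_one : K;
  sl_mulA : forall x y z,
    fglift (sl_mul x) (sl_mul y z) = fglift (fun k => sl_mul k z) (sl_mul x y);
  sl_mul1 : forall x, sl_mul sl_one x = << x >>;
  sl_mulr1 : forall x, sl_mul x sl_one = << x >>
}.

Definition structure_algebra (L : structure_law) : Type := {freeg K / R}.

Variable L : structure_law.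
Local Notation A := (structure_algebra L).

HB.instance Definition _ := GRing.Lmodule.copy A {freeg K / R}.

Definition basis_elt (k : K) : A := << k >>.

Definition sa_mul (f g : A) : A :=
  fglift (fun x => fglift (fun y => sl_mul L x y) g) f.

Lemma sa_mulUU x y : sa_mul (basis_elt x) (basis_elt y) = sl_mul L x y.
Proof. by rewrite /sa_mul !fgliftU1. Qed.

Lemma sa_mul_linl g : linear (sa_mul^~ g).
Proof. by move=> c x y; rewrite /sa_mul linearP. Qed.

Lemma sa_mul_linr f : linear (sa_mul f).
Proof. exact: fglift_linear_fun. Qed.

Lemma sa_mulUr x g : sa_mul (basis_elt x) g = fglift (sl_mul L x) g.
Proof. by rewrite /sa_mul fgliftU1. Qed.

Lemma sa_mulUl f y : sa_mul f (basis_elt y) = fglift (sl_mul L ^~ y) f.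
Proof. by apply: fglift_eq => x; rewrite fgliftU1. Qed.

Lemma sa_mulA : associative sa_mul.
Proof.
move=> f g h; move: f; apply: freeg_linP => [c x y|c x y|x].
- by rewrite sa_mul_linl.
- by rewrite !sa_mul_linl.
move: g; apply: freeg_linP => [c y z|c y z|y].
- by rewrite sa_mul_linl sa_mul_linr.
- by rewrite sa_mul_linr sa_mul_linl.
move: h; apply: freeg_linP => [c u v|c u v|z].
- by rewrite !sa_mul_linr.
- by rewrite sa_mul_linr.
by rewrite !sa_mulUU sa_mulUr sa_mulUl sl_mulA.
Qed.

Lemma sa_mul1 : left_id (basis_elt (sl_one L)) sa_mul.
Proof.
apply: freeg_linP => [c x y|c x y|x] //; first by rewrite sa_mul_linr.
by rewrite sa_mulUU sl_mul1.
Qed.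

Lemma sa_mulr1 : right_id (basis_elt (sl_one L)) sa_mul.
Proof.
apply: freeg_linP => [c x y|c x y|x] //; first by rewrite sa_mul_linl.
by rewrite sa_mulUU sl_mulr1.
Qed.

Lemma sa_mulDl : left_distributive sa_mul +%R.
Proof. by move=> x y z; have := sa_mul_linl z 1 x y; rewrite !scale1r. Qed.

Lemma sa_mulDr : right_distributive sa_mul +%R.
Proof. by move=> x y z; have := sa_mul_linr x 1 y z; rewrite !scale1r. Qed.

Lemma sa_1_neq0 : basis_elt (sl_one L) != 0.
Proof. by rewrite /basis_elt freegU_eq0 oner_eq0. Qed.

HB.instance Definition _ := GRing.Zmodule_isNzRing.Build A
  sa_mulA sa_mul1 sa_mulr1 sa_mulDl sa_mulDr sa_1_neq0.

Lemma sa_scaleAl (c : R) (x y : A) : c *: (x * y) = (c *: x) * y.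
Proof. by have := sa_mul_linl y c x 0; rewrite !addr0 /sa_mul raddf0 addr0. Qed.

Lemma sa_scaleAr (c : R) (x y : A) : c *: (x * y) = x * (c *: y).
Proof.
have := sa_mul_linr x c y 0.
by rewrite addr0 -[sa_mul x 0]/(x * 0) mulr0 addr0 => /esym.
Qed.

HB.instance Definition _ := GRing.Lmodule_isLalgebra.Build R A sa_scaleAl.
HB.instance Definition _ := GRing.Lalgebra_isAlgebra.Build R A sa_scaleAr.

End StructureAlgebra.

Section QuotientAlgebra.
Context (R : pzRingType) (A : algType R) (S : A -> Prop).

Inductive ideal_gen : A -> Prop :=
| ideal_gen_in x : S x -> ideal_gen x
| ideal_gen0 : ideal_gen 0
| ideal_genB x y : ideal_gen x -> ideal_gen y -> ideal_gen (x - y)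
| ideal_genMl a x : ideal_gen x -> ideal_gen (a * x)
| ideal_genMr a x : ideal_gen x -> ideal_gen (x * a).

Lemma ideal_genN x : ideal_gen x -> ideal_gen (- x).
Proof. by move=> Ix; rewrite -sub0r; apply: ideal_genB => //; apply: ideal_gen0. Qed.

Lemma ideal_genD x y : ideal_gen x -> ideal_gen y -> ideal_gen (x + y).
Proof. by move=> Ix Iy; rewrite -[y]opprK; apply/ideal_genB/ideal_genN. Qed.

Lemma ideal_genZ c x : ideal_gen x -> ideal_gen (c *: x).
Proof.
by move=> Ix; rewrite -[x]mul1r scalerAl; apply: ideal_genMl.
Qed.

Definition ideal_equiv (x y : A) : bool := `[< ideal_gen (x - y) >].

Lemma ideal_equiv_refl : reflexive ideal_equiv.
Proof. by move=> x; apply/asboolP; rewrite subrr; apply: ideal_gen0. Qed.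

Lemma ideal_equiv_sym : ssrbool.symmetric ideal_equiv.
Proof.
by move=> x y; apply/asboolP/asboolP => /ideal_genN; rewrite opprB.
Qed.

Lemma ideal_equiv_trans : transitive ideal_equiv.
Proof.
move=> y x z /asboolP Ixy /asboolP Iyz; apply/asboolP.
by rewrite -(subrKA y); apply: ideal_genD.
Qed.

Canonical ideal_equiv_equiv :=
  EquivRel ideal_equiv ideal_equiv_refl ideal_equiv_sym ideal_equiv_trans.
Canonical ideal_equiv_direct := defaultEncModRel ideal_equiv.

Lemma ideal_gen_proper (B : nzRingType) (f : {rmorphism A -> B}) :
  (forall x, S x -> f x = 0) -> ~ ideal_gen 1.
Proof.
move=> fS I1; have: f 1 = 0.
  elim: I1 => [x /fS//||x y _ fx _ fy|a x _ fx|a x _ fx].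
  - by rewrite raddf0.
  - by rewrite rmorphB fx fy subrr.
  - by rewrite rmorphM fx mulr0.
  - by rewrite rmorphM fx mul0r.
by apply/eqP; rewrite rmorph1 oner_eq0.
Qed.

(* The [algType] of the library requires 1 != 0, so the quotient is formed for
   proper ideals only. *)
Definition quot_alg of ~ ideal_gen 1 : Type := {eq_quot ideal_equiv}.

Hypothesis proper : ~ ideal_gen 1.

Local Notation Q := (quot_alg proper).

HB.instance Definition _ := Choice.on Q.
HB.instance Definition _ := EqQuotient.on Q.

Definition quot_pi (x : A) : Q := \pi_Q x.

Lemma quot_piP x y : quot_pi x = quot_pi y <-> ideal_gen (x - y).
Proof.
split=> [/eqP|Ixy]; first by rewrite eqmodE => /asboolP.
by apply/eqP; rewrite eqmodE; apply/asboolP.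
Qed.

Lemma quot_ind (P : Q -> Prop) : (forall x, P (quot_pi x)) -> forall u, P u.
Proof. by move=> Ppi u; rewrite -[u]reprK; apply: Ppi. Qed.

Lemma repr_quot_pi x : ideal_gen (repr (quot_pi x) - x).
Proof. by apply/quot_piP; rewrite /quot_pi reprK. Qed.

Definition quot_zero : Q := quot_pi 0.
Definition quot_one : Q := quot_pi 1.
Definition quot_opp (u : Q) : Q := quot_pi (- repr u).
Definition quot_add (u v : Q) : Q := quot_pi (repr u + repr v).
Definition quot_mul (u v : Q) : Q := quot_pi (repr u * repr v).
Definition quot_scale (c : R) (u : Q) : Q := quot_pi (c *: repr u).

Lemma quot_oppE x : quot_opp (quot_pi x) = quot_pi (- x).
Proof. by apply/quot_piP; rewrite -opprD; apply/ideal_genN/repr_quot_pi. Qed.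

Lemma quot_addE x y : quot_add (quot_pi x) (quot_pi y) = quot_pi (x + y).
Proof.
by apply/quot_piP; rewrite opprD addrACA; apply: ideal_genD; apply: repr_quot_pi.
Qed.

Lemma quot_mulE x y : quot_mul (quot_pi x) (quot_pi y) = quot_pi (x * y).
Proof.
apply/quot_piP; set x' := repr _; set y' := repr _.
rewrite -(subrKA (x' * y)) -mulrBr -mulrBl; apply: ideal_genD.
  exact/ideal_genMl/repr_quot_pi.
exact/ideal_genMr/repr_quot_pi.
Qed.

Lemma quot_scaleE c x : quot_scale c (quot_pi x) = quot_pi (c *: x).
Proof. by apply/quot_piP; rewrite -scalerBr; apply/ideal_genZ/repr_quot_pi. Qed.

Lemma quot_addA : associative quot_add.
Proof.
by elim/quot_ind=> x; elim/quot_ind=> y; elim/quot_ind=> z; rewrite !quot_addE addrA.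
Qed.

Lemma quot_addC : commutative quot_add.
Proof. by elim/quot_ind=> x; elim/quot_ind=> y; rewrite !quot_addE addrC. Qed.

Lemma quot_add0 : left_id quot_zero quot_add.
Proof. by elim/quot_ind=> x; rewrite quot_addE add0r. Qed.

Lemma quot_addN : left_inverse quot_zero quot_opp quot_add.
Proof. by elim/quot_ind=> x; rewrite quot_oppE quot_addE addNr. Qed.

HB.instance Definition _ :=
  GRing.isZmodule.Build Q quot_addA quot_addC quot_add0 quot_addN.

Lemma quot_mulA : associative quot_mul.
Proof.
by elim/quot_ind=> x; elim/quot_ind=> y; elim/quot_ind=> z; rewrite !quot_mulE mulrA.
Qed.

Lemma quot_mul1 : left_id quot_one quot_mul.
Proof. by elim/quot_ind=> x; rewrite quot_mulE mul1r. Qed.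

Lemma quot_mulr1 : right_id quot_one quot_mul.
Proof. by elim/quot_ind=> x; rewrite quot_mulE mulr1. Qed.

Lemma quot_mulDl : left_distributive quot_mul quot_add.
Proof.
elim/quot_ind=> x; elim/quot_ind=> y; elim/quot_ind=> z.
by rewrite !(quot_mulE, quot_addE) mulrDl.
Qed.

Lemma quot_mulDr : right_distributive quot_mul quot_add.
Proof.
elim/quot_ind=> x; elim/quot_ind=> y; elim/quot_ind=> z.
by rewrite !(quot_mulE, quot_addE) mulrDr.
Qed.

Lemma quot_1_neq0 : quot_one != quot_zero.
Proof. by apply/eqP => /quot_piP; rewrite subr0. Qed.

HB.instance Definition _ := GRing.Zmodule_isNzRing.Build Q
  quot_mulA quot_mul1 quot_mulr1 quot_mulDl quot_mulDr quot_1_neq0.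

Lemma quot_scaleA a b (u : Q) :
  quot_scale a (quot_scale b u) = quot_scale (a * b) u.
Proof. by elim/quot_ind: u => x; rewrite !quot_scaleE scalerA. Qed.

Lemma quot_scale1 : left_id 1 quot_scale.
Proof. by elim/quot_ind=> x; rewrite quot_scaleE scale1r. Qed.

Lemma quot_scaleDr : right_distributive quot_scale +%R.
Proof.
move=> a; elim/quot_ind=> x; elim/quot_ind=> y.
rewrite -[_ + _]/(quot_add _ _) -[RHS]/(quot_add _ _).
by rewrite !(quot_scaleE, quot_addE) scalerDr.
Qed.

Lemma quot_scaleDl (u : Q) : {morph quot_scale^~ u : a b / a + b}.
Proof.
elim/quot_ind: u => x a b /=.
by rewrite -[RHS]/(quot_add _ _) !(quot_scaleE, quot_addE) scalerDl.
Qed.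

HB.instance Definition _ := GRing.Zmodule_isLmodule.Build R Q
  quot_scaleA quot_scale1 quot_scaleDr quot_scaleDl.

Lemma quot_scalerAl (c : R) (u v : Q) : c *: (u * v) = (c *: u) * v.
Proof.
elim/quot_ind: u => x; elim/quot_ind: v => y.
rewrite -[LHS]/(quot_scale _ (quot_mul _ _)) -[RHS]/(quot_mul (quot_scale _ _) _).
by rewrite !(quot_scaleE, quot_mulE) scalerAl.
Qed.

Lemma quot_scalerAr (c : R) (u v : Q) : c *: (u * v) = u * (c *: v).
Proof.
elim/quot_ind: u => x; elim/quot_ind: v => y.
rewrite -[LHS]/(quot_scale _ (quot_mul _ _)) -[RHS]/(quot_mul _ (quot_scale _ _)).
by rewrite !(quot_scaleE, quot_mulE) scalerAr.
Qed.

HB.instance Definition _ := GRing.Lmodule_isLalgebra.Build R Q quot_scalerAl.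
HB.instance Definition _ := GRing.Lalgebra_isAlgebra.Build R Q quot_scalerAr.

Lemma quot_pi_is_linear : linear quot_pi.
Proof.
move=> c x y; rewrite -[RHS]/(quot_add (quot_scale _ _) _).
by rewrite quot_scaleE quot_addE.
Qed.

Lemma quot_pi_is_monoid_morphism : monoid_morphism quot_pi.
Proof. by split=> // x y; rewrite -[RHS]/(quot_mul _ _) quot_mulE. Qed.

HB.instance Definition _ :=
  GRing.isLinear.Build R A Q *:%R quot_pi quot_pi_is_linear.
HB.instance Definition _ :=
  GRing.isMonoidMorphism.Build A Q quot_pi quot_pi_is_monoid_morphism.

Section Descent.
Context (B : nzRingType) (f : {rmorphism A -> B}).
Hypothesis fS : forall x, S x -> f x = 0.

Definition quot_descend (u : Q) : B := f (repr u).

Lemma quot_descendE x : quot_descend (quot_pi x) = f x.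
Proof.
apply/eqP; rewrite -subr_eq0 -rmorphB; apply/eqP.
elim: (repr_quot_pi x) => [y /fS//||y z _ fy _ fz|a y _ fy|a y _ fy].
- by rewrite raddf0.
- by rewrite rmorphB fy fz subrr.
- by rewrite rmorphM fy mulr0.
- by rewrite rmorphM fy mul0r.
Qed.

Lemma quot_descend_is_additive : zmod_morphism quot_descend.
Proof.
elim/quot_ind=> x; elim/quot_ind=> y.
by rewrite -raddfB !quot_descendE rmorphB.
Qed.

Lemma quot_descend_is_monoid_morphism : monoid_morphism quot_descend.
Proof.
split; first by rewrite -(rmorph1 quot_pi) quot_descendE rmorph1.
elim/quot_ind=> x; elim/quot_ind=> y.
by rewrite -rmorphM !quot_descendE rmorphM.
Qed.

End Descent.

End QuotientAlgebra.

Section BaseChange.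
Context (R : pzRingType) (S : comNzRingType) (phi : {rmorphism R -> S}).
Context (A : algType R).

Local Notation K := (S * A)%type.

Definition pair_mul (x y : K) : {freeg K / S} := << (x.1 * y.1, x.2 * y.2) >>.

Lemma pair_mulA (x y z : K) :
  fglift (pair_mul x) (pair_mul y z) =
  fglift (fun k => pair_mul k z) (pair_mul x y).
Proof. by rewrite !fgliftU1 /pair_mul /= !mulrA. Qed.

Lemma pair_mul1 (x : K) : pair_mul (1, 1) x = << x >>.
Proof. by case: x => s a; rewrite /pair_mul /= !mul1r. Qed.

Lemma pair_mulr1 (x : K) : pair_mul x (1, 1) = << x >>.
Proof. by case: x => s a; rewrite /pair_mul /= !mulr1. Qed.

Definition pair_law : structure_law S K :=
  StructureLaw pair_mulA pair_mul1 pair_mulr1.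

Definition pair_elt (s : S) (a : A) : structure_algebra pair_law :=
  basis_elt pair_law (s, a).

Inductive tensor_rel : structure_algebra pair_law -> Prop :=
| tensor_relDl s1 s2 a :
    tensor_rel (pair_elt (s1 + s2) a - (pair_elt s1 a + pair_elt s2 a))
| tensor_relDr s a1 a2 :
    tensor_rel (pair_elt s (a1 + a2) - (pair_elt s a1 + pair_elt s a2))
| tensor_relM s r a :
    tensor_rel (pair_elt (s * phi r) a - pair_elt s (r *: a))
| tensor_relZ s1 s2 a :
    tensor_rel (pair_elt (s1 * s2) a - s1 *: pair_elt s2 a).

Lemma tensor_proper (e : {rmorphism A -> S}) :
  (forall r a, e (r *: a) = phi r * e a) -> ~ ideal_gen tensor_rel 1.
Proof.
move=> eZ; pose F (x : structure_algebra pair_law) : S :=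
  fglift (fun k : K => k.1 * e k.2 : S^o) x.
have FU s a : F (pair_elt s a) = s * e a by rewrite /F fgliftU1.
have FL : linear (F : _ -> S^o) by move=> c x y; rewrite /F linearP.
have FB : zmod_morphism F by move=> x y; rewrite /F raddfB.
have FZ c x : F (c *: x) = c * F x by rewrite /F linearZ.
have FD x y : F (x + y) = F x + F y by rewrite /F raddfD.
have FM : monoid_morphism F.
  split; first by rewrite -[1]/(pair_elt 1 1) FU rmorph1 mulr1.
  move=> x y; move: x.
  apply: (@freeg_linP _ _ S^o _ (fun x => F x * F y)) => [c u v|c u v|[s a]].
  - by rewrite mulrDl -scalerAl FD FZ.
  - by rewrite FD FZ mulrDl -mulrA.
  rewrite -[<< _ >>]/(pair_elt s a) FU; move: y.
  apply: (@freeg_linP _ _ S^o _ (fun y => _ * F y)) => [c u v|c u v|[t b]].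
  - by rewrite mulrDr -scalerAr FD FZ.
  - by rewrite FD FZ mulrDr mulrCA.
  rewrite -[<< _ >>]/(pair_elt t b) FU.
  rewrite [_ * _ in LHS]sa_mulUU -[sl_mul _ _ _]/(pair_elt _ _) FU /=.
  by rewrite rmorphM mulrACA.
pose h1 := GRing.isZmodMorphism.Build _ _ F FB.
pose h2 := GRing.isMonoidMorphism.Build _ _ F FM.
pose G : {rmorphism structure_algebra pair_law -> S} := HB.pack F h1 h2.
apply: (@ideal_gen_proper _ _ _ _ G) => x [] * ; rewrite -[G _]/(F _).
- by rewrite FB FD !FU mulrDl subrr.
- by rewrite FB FD !FU rmorphD mulrDr subrr.
- by rewrite FB !FU eZ mulrA subrr.
- by rewrite FB FZ !FU mulrA subrr.
Qed.

(* The S-algebra S (x)_R A, where r : R acts on S by multiplication by phi r,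
   with product (s1 (x) a1) * (s2 (x) a2) = (s1 * s2) (x) (a1 * a2).  The span
   of [tensor_rel] is already a two-sided ideal: multiplication by a
   [pair_elt] maps relations to relations. *)
Definition base_change (proper : ~ ideal_gen tensor_rel 1) : Type :=
  quot_alg proper.

HB.instance Definition _ proper := GRing.Algebra.on (base_change proper).

Definition pure_tensor proper (s : S) (a : A) : base_change proper :=
  quot_pi proper (pair_elt s a).

End BaseChange.

(* Lambda, the disjoint union of the Lambda_n; the length n is the size of the
   sequence, and zero entries are allowed. *)
Record intpart := IntPart {
  parts :> seq nat;
  parts_sorted : sorted leq parts
}.

HB.instance Definition _ := [isSub for parts].
HB.instance Definition _ := [Choice of intpart by <:].

Definition rearr (s : seq nat) : intpart :=
  IntPart (sort_sorted leq_total s).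

Lemma rearr_perm s1 s2 : perm_eq s1 s2 -> rearr s1 = rearr s2.
Proof.
by move=> s12; apply/val_inj/(perm_sortP leq_total leq_trans anti_leq).
Qed.

Lemma rearr_id (p : intpart) : rearr p = p.
Proof. exact/val_inj/(sorted_sort leq_trans)/parts_sorted. Qed.

Section Reineke.
Variable d : nat.

Definition reineke_shift m (s : seq nat) := [seq (x + m * d.-1)%N | x <- s].

Lemma reineke_shiftD m n s :
  reineke_shift m (reineke_shift n s) = reineke_shift (m + n) s.
Proof.
rewrite /reineke_shift -map_comp; apply: eq_map => x /=.
by rewrite mulnDl -addnA [(n * _ + _)%N]addnC.
Qed.

Definition reineke_op (mu nu : intpart) : intpart :=
  rearr (mu ++ reineke_shift (size mu) nu).

Lemma size_reineke_op mu nu : size (reineke_op mu nu) = (size mu + size nu)%N.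
Proof. by rewrite size_sort size_cat size_map. Qed.

Lemma reineke_opA : associative reineke_op.
Proof.
move=> mu nu rho; apply: rearr_perm; rewrite size_reineke_op.
have p1 : perm_eq (reineke_op mu nu) (mu ++ reineke_shift (size mu) nu).
  by rewrite perm_sort.
have p2 : perm_eq (reineke_op nu rho) (nu ++ reineke_shift (size nu) rho).
  by rewrite perm_sort.
rewrite perm_sym (perm_trans (y := (mu ++ reineke_shift (size mu) nu) ++
  reineke_shift (size mu + size nu) rho)) ?perm_cat2r // perm_sym.
rewrite -catA perm_cat2l.
rewrite (perm_trans (perm_map _ p2)) // map_cat.
by rewrite -!/(reineke_shift _ _) reineke_shiftD.
Qed.

Lemma reineke_op0 mu : reineke_op (rearr [::]) mu = mu.
Proof.
rewrite -[RHS]rearr_id; congr rearr => /=.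
by rewrite -[RHS]map_id; apply: eq_map => x; rewrite mul0n addn0.
Qed.

Lemma reineke_opr0 mu : reineke_op mu (rearr [::]) = mu.
Proof. by rewrite -[RHS]rearr_id /reineke_op /= cats0. Qed.

Definition reineke_mul (mu nu : intpart) : {freeg intpart / rat} :=
  << reineke_op mu nu >>.

Lemma reineke_mulA mu nu rho :
  fglift (reineke_mul mu) (reineke_mul nu rho) =
  fglift (fun k => reineke_mul k rho) (reineke_mul mu nu).
Proof. by rewrite !fgliftU1 /reineke_mul reineke_opA. Qed.

Lemma reineke_mul0 mu : reineke_mul (rearr [::]) mu = << mu >>.
Proof. by rewrite /reineke_mul reineke_op0. Qed.

Lemma reineke_mulr0 mu : reineke_mul mu (rearr [::]) = << mu >>.
Proof. by rewrite /reineke_mul reineke_opr0. Qed.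

Definition reineke_law : structure_law rat intpart :=
  StructureLaw reineke_mulA reineke_mul0 reineke_mulr0.

(* A^d(Lambda) *)
Definition reineke_algebra : Type := structure_algebra reineke_law.

HB.instance Definition _ := GRing.Algebra.on reineke_algebra.

Definition reineke_elt (lam : intpart) : reineke_algebra :=
  basis_elt reineke_law lam.

End Reineke.

Section Evaluation.
Context (R : comNzRingType).

Definition addseq (s t : seq nat) := [seq (x.1 + x.2)%N | x <- zip s t].

Lemma size_addseq s t : size s = size t -> size (addseq s t) = size s.
Proof. by move=> st; rewrite size_map size1_zip ?st. Qed.

Lemma addseqA s t u : addseq (addseq s t) u = addseq s (addseq t u).
Proof.
elim: s t u => [|x s IHs] [|y t] [|z u] //=.
by rewrite /addseq /= addnA; congr cons; apply: IHs.
Qed.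

Lemma addseq_cat s1 s2 t1 t2 : size s1 = size t1 ->
  addseq (s1 ++ s2) (t1 ++ t2) = addseq s1 t1 ++ addseq s2 t2.
Proof. by move=> st; rewrite /addseq zip_cat // map_cat. Qed.

Lemma addseq0 s : addseq s (nseq (size s) 0%N) = s.
Proof. by elim: s => //= x s IHs; rewrite /addseq /= addn0; congr cons. Qed.

(* Multiplication of x^s by the polynomial p, where x^s stands for the basis
   element s. *)
Definition mul_monom n (s : seq nat) (p : {mpoly R[n]}) : {freeg (seq nat) / R} :=
  \sum_(k <- msupp p) p@_k *: << addseq s k >>.

Lemma mul_monomE n s (p : {mpoly R[n]}) :
  mul_monom s p = fglift (fun k : 'X_{1..n} => << addseq s k >>) (mpoly_val p).
Proof. by rewrite fgliftE. Qed.

Lemma mul_monom_is_linear n s : linear (@mul_monom n s).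
Proof. by move=> c p q; rewrite !mul_monomE -linearP. Qed.

HB.instance Definition _ n s :=
  GRing.isLinear.Build R {mpoly R[n]} {freeg (seq nat) / R} *:%R (@mul_monom n s)
    (mul_monom_is_linear s).

Lemma mul_monomX n s (k : 'X_{1..n}) : mul_monom s 'X_[k] = << addseq s k >>.
Proof. by rewrite /mul_monom msuppX big_seq1 mcoeffX eqxx scale1r. Qed.

Definition subst_var n1 n2 (f : 'I_n1 -> 'I_n2) (p : {mpoly R[n1]}) :
  {mpoly R[n2]} := p \mPo [tuple 'X_(f i) | i < n1].

HB.instance Definition _ n1 n2 f := GRing.RMorphism.copy (@subst_var n1 n2 f)
  (comp_mpoly [tuple 'X_(f i) | i < n1]).
HB.instance Definition _ n1 n2 f := GRing.Linear.copy (@subst_var n1 n2 f)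
  (comp_mpoly [tuple 'X_(f i) | i < n1]).

Lemma subst_varX n1 n2 (f : 'I_n1 -> 'I_n2) (i : 'I_n1) :
  subst_var f 'X_i = 'X_(f i).
Proof. by rewrite /subst_var comp_mpolyXU -tnth_nth tnth_mktuple. Qed.

Lemma mul_monom_cast n1 n2 (e : n1 = n2) s (p : {mpoly R[n1]}) :
  mul_monom s (subst_var (cast_ord e) p) = mul_monom s p.
Proof.
case: n2 / e; rewrite /subst_var -[p in RHS]comp_mpoly_id.
suff -> : [tuple 'X_(cast_ord erefl i) | i < n1] =
          [tuple 'X_i | i < n1] :> n1.-tuple {mpoly R[n1]} by [].
by apply: eq_from_tnth => i; rewrite !tnth_mktuple cast_ord_id.
Qed.

Lemma subst_var_lshift n r (k : 'X_{1..n}) :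
  subst_var (lshift r) 'X_[k] = 'X_[[multinom of k ++ nseq r 0%N]].
Proof.
rewrite /subst_var comp_mpolyX [RHS]mpolyXE_id big_split_ord /=.
rewrite [X in _ * X]big1 ?mulr1 => [|i _]; last first.
  by rewrite multinomE tnth_rshift (tnth_nth 0%N) nth_nseq if_same expr0.
by apply: eq_bigr => i _; rewrite tnth_mktuple multinomE tnth_lshift.
Qed.

Lemma subst_var_rshift n l (k : 'X_{1..n}) :
  subst_var (@rshift l n) 'X_[k] = 'X_[[multinom of nseq l 0%N ++ k]].
Proof.
rewrite /subst_var comp_mpolyX [RHS]mpolyXE_id big_split_ord /=.
rewrite [X in X * _]big1 ?mul1r => [|i _]; last first.
  by rewrite multinomE tnth_lshift (tnth_nth 0%N) nth_nseq if_same expr0.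
by apply: eq_bigr => i _; rewrite tnth_mktuple multinomE tnth_rshift.
Qed.

Lemma mnm_addE n (k j : 'X_{1..n}) : (k + j)%MM = addseq k j :> seq nat.
Proof.
apply: (@eq_from_nth _ 0%N) => [|i].
  by rewrite size_addseq !size_tuple.
rewrite size_tuple => lt_i.
have nthE (m : 'X_{1..n}) : nth 0%N m i = m (Ordinal lt_i).
  by rewrite (mnm_nth 0%N).
rewrite nthE mnmDE (nth_map (0%N, 0%N)) ?size1_zip ?size_tuple //.
by rewrite nth_zip ?size_tuple // -!nthE.
Qed.

Lemma mul_monom1 n s : size s = n -> mul_monom s (1 : {mpoly R[n]}) = << s >>.
Proof.
move=> sn; rewrite -mpolyX0 mul_monomX; congr << _ >>.
suff -> : (0%MM : 'X_{1..n}) = nseq n 0%N :> seq nat by rewrite -sn addseq0.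
apply: (@eq_from_nth _ 0%N) => [|i]; first by rewrite size_tuple size_nseq.
rewrite size_tuple => lt_i; rewrite nth_nseq lt_i.
by rewrite -[i]/(val (Ordinal lt_i)) -mnm_nth mnm0E.
Qed.

Lemma mul_monomM n s (k : 'X_{1..n}) (p : {mpoly R[n]}) :
  mul_monom (addseq s k) p = mul_monom s ('X_[k] * p).
Proof.
rewrite [in RHS](mpolyE p) mulr_sumr linear_sum; apply: eq_bigr => j _ /=.
by rewrite -scalerAr linearZ /= -mpolyXD mul_monomX mnm_addE addseqA.
Qed.

End Evaluation.

Section Quantum.
Variable d : nat.

Local Notation Rq := {poly rat}.

(* The variables x_1, ..., x_m are the 'X_(lshift n t) and x_(m+1), ...,
   x_(m+n) are the 'X_(rshift m s); q is 'X. *)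
Definition structure_poly m n : {mpoly Rq[m + n]} :=
  \prod_(s < n) \prod_(t < m)
     ('X_(rshift m s) - ('X : Rq) *: 'X_(lshift n t)) ^+ d.-1.

(* The coefficient c_{m,n}^{a,b}, where k is the concatenation of a and b. *)
Definition structure_coef m n (k : 'X_{1..m + n}) : Rq :=
  (structure_poly m n)@_k.

(* The sum ranges over the finitely many (a, b) with a nonzero coefficient.  If
   mu or nu is empty then [structure_poly] is an empty product, equal to 1, so
   that the empty sequence is the unit. *)
Definition hat_mul (mu nu : seq nat) : {freeg (seq nat) / Rq} :=
  \sum_(k <- msupp (structure_poly (size mu) (size nu)))
     structure_coef k *: << addseq (mu ++ nu) k >>.

Lemma hat_mulE m n mu nu : size mu = m -> size nu = n ->
  hat_mul mu nu = mul_monom (mu ++ nu) (structure_poly m n).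
Proof. by move=> <- <-. Qed.

Lemma mul_monom_hatl n r s rho (p : {mpoly Rq[n]}) :
  size s = n -> size rho = r ->
  fglift (hat_mul^~ rho) (mul_monom s p) =
  mul_monom (s ++ rho) (subst_var (lshift r) p * structure_poly n r).
Proof.
move=> sn rhor; rewrite [in RHS](mpolyE p) !linear_sum mulr_suml linear_sum.
apply: eq_bigr => k _ /=; rewrite !linearZ /= -scalerAl linearZ fgliftU1.
rewrite (@hat_mulE n r) ?size_addseq ?size_tuple // subst_var_lshift /= -mul_monomM.
by rewrite addseq_cat ?size_tuple // -rhor addseq0.
Qed.

Lemma mul_monom_hatr n l s mu (p : {mpoly Rq[n]}) :
  size s = n -> size mu = l ->
  fglift (hat_mul mu) (mul_monom s p) =
  mul_monom (mu ++ s) (subst_var (@rshift l n) p * structure_poly l n).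
Proof.
move=> sn mul; rewrite [in RHS](mpolyE p) !linear_sum mulr_suml linear_sum.
apply: eq_bigr => k _ /=; rewrite !linearZ /= -scalerAl linearZ fgliftU1.
rewrite (@hat_mulE l n) ?size_addseq ?size_tuple // subst_var_rshift /= -mul_monomM.
by rewrite addseq_cat ?size_nseq // -mul addseq0.
Qed.

Lemma subst_var_structure_poly m n N (f : 'I_(m + n) -> 'I_N) :
  subst_var f (structure_poly m n) =
  \prod_(s < n) \prod_(t < m)
     ('X_(f (rshift m s)) - ('X : Rq) *: 'X_(f (lshift n t))) ^+ d.-1.
Proof.
rewrite rmorph_prod; apply: eq_bigr => s _; rewrite rmorph_prod.
by apply: eq_bigr => t _; rewrite rmorphXn rmorphB /= linearZ /= !subst_varX.
Qed.

Lemma structure_polyA m n p :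
  subst_var (cast_ord (esym (addnA m n p)))
    (subst_var (lshift p) (structure_poly m n) * structure_poly (m + n) p) =
  subst_var (@rshift m (n + p)) (structure_poly n p) * structure_poly m (n + p).
Proof.
set c := cast_ord _.
pose F i j : {mpoly Rq[m + (n + p)]} := ('X_i - ('X : Rq) *: 'X_j) ^+ d.-1.
have cF k i j : subst_var c (('X_i - ('X : Rq) *: 'X_j) ^+ k) =
    ('X_(c i) - ('X : Rq) *: 'X_(c j)) ^+ k.
  by rewrite rmorphXn rmorphB /= linearZ /= !subst_varX.
rewrite rmorphM /= (subst_var_structure_poly (lshift p)).
rewrite (subst_var_structure_poly (@rshift m (n + p))).
have -> : subst_var c (structure_poly (m + n) p) =
    (\prod_(s < p) \prod_(t < m)
       F (rshift m (rshift n s)) (lshift (n + p) t)) *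
    (\prod_(s < p) \prod_(t < n)
       F (rshift m (rshift n s)) (rshift m (lshift p t))).
  rewrite subst_var_structure_poly -big_split; apply: eq_bigr => s _ /=.
  rewrite big_split_ord; congr (_ * _); apply: eq_bigr => t _;
    by congr (('X_ _ - _ *: 'X_ _) ^+ _); apply: val_inj; rewrite /= ?addnA.
rewrite /structure_poly big_split_ord [RHS]mulrC -[RHS]mulrA.
congr (_ * (_ * _)).
rewrite rmorph_prod; apply: eq_bigr => s _; rewrite rmorph_prod.
apply: eq_bigr => t _ /=; rewrite cF.
by congr (('X_ _ - _ *: 'X_ _) ^+ _); apply: val_inj.
Qed.

Lemma hat_mulA mu nu rho :
  fglift (hat_mul mu) (hat_mul nu rho) =
  fglift (hat_mul^~ rho) (hat_mul mu nu).
Proof.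
rewrite (mul_monom_hatl _ _ (erefl (size rho))) ?size_cat //.
rewrite (mul_monom_hatr _ _ (erefl (size mu))) ?size_cat //.
by rewrite -structure_polyA mul_monom_cast catA.
Qed.

Lemma hat_mul0 nu : hat_mul [::] nu = << nu >>.
Proof.
rewrite (@hat_mulE 0 (size nu)) // /structure_poly big1; last first.
  by move=> s _; rewrite big_ord0.
by rewrite mul_monom1.
Qed.

Lemma hat_mulr0 mu : hat_mul mu [::] = << mu >>.
Proof.
rewrite (@hat_mulE (size mu) 0) // /structure_poly big_ord0.
by rewrite mul_monom1 cats0 ?addn0.
Qed.

Definition hat_law : structure_law Rq (seq nat) :=
  StructureLaw hat_mulA hat_mul0 hat_mulr0.

(* A^d_q(hat Lambda) *)
Definition hat_algebra : Type := structure_algebra hat_law.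

HB.instance Definition _ := GRing.Algebra.on hat_algebra.

Definition hat_elt (mu : seq nat) : hat_algebra := basis_elt hat_law mu.

Inductive perm_rel : hat_algebra -> Prop :=
| perm_rel_in mu nu : perm_eq mu nu -> perm_rel (hat_elt mu - hat_elt nu).

(* The coefficient of the empty sequence is an algebra morphism, which shows
   that the quotients below are not zero. *)
Definition hat_aug (x : hat_algebra) : Rq := coeff [::] x.

Lemma hat_augU mu : hat_aug (hat_elt mu) = (mu == [::])%:R.
Proof. by rewrite /hat_aug coeffU mul1r. Qed.

Lemma hat_augD x y : hat_aug (x + y) = hat_aug x + hat_aug y.
Proof. exact: coeffD. Qed.

Lemma hat_augZ c x : hat_aug (c *: x) = c * hat_aug x.
Proof. exact: coeffZ. Qed.

Lemma hat_aug_mul mu nu :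
  coeff [::] (hat_mul mu nu) = (mu == [::])%:R * (nu == [::])%:R.
Proof.
have [->|mu0] := eqVneq mu [::]; first by rewrite hat_mul0 coeffU !mul1r.
rewrite mul0r raddf_sum /= big1 // => k _.
rewrite coeffZ coeffU mul1r; case: eqP => [/(congr1 size)|_]; last by rewrite mulr0.
rewrite size_addseq ?size_tuple ?size_cat //=.
by case: mu mu0 k.
Qed.

Lemma hat_aug_is_zmod_morphism : zmod_morphism hat_aug.
Proof. exact: coeffB. Qed.

Lemma hat_aug_is_monoid_morphism : monoid_morphism hat_aug.
Proof.
split=> [|x y]; first by rewrite hat_augU eqxx.
move: x; apply: (@freeg_linP _ _ Rq^o _ (fun x => hat_aug x * hat_aug y)).
- by move=> c u v /=; rewrite mulrDl -scalerAl hat_augD hat_augZ.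
- by move=> c u v /=; rewrite hat_augD hat_augZ mulrDl -mulrA.
move=> mu; rewrite -[<< mu >>]/(hat_elt mu); move: y.
apply: (@freeg_linP _ _ Rq^o _ (fun y => _ * hat_aug y)).
- by move=> c u v /=; rewrite mulrDr -scalerAr hat_augD hat_augZ.
- by move=> c u v /=; rewrite hat_augD hat_augZ mulrDr mulrCA.
move=> nu; rewrite -[<< nu >>]/(hat_elt nu) !hat_augU -hat_aug_mul.
by rewrite [_ * _ in LHS]sa_mulUU.
Qed.

HB.instance Definition _ :=
  GRing.isZmodMorphism.Build hat_algebra Rq hat_aug hat_aug_is_zmod_morphism.
HB.instance Definition _ :=
  GRing.isMonoidMorphism.Build hat_algebra Rq hat_aug
    hat_aug_is_monoid_morphism.

Lemma hat_aug_perm x : perm_rel x -> hat_aug x = 0.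
Proof.
case=> mu nu mu_nu; rewrite rmorphB /= !hat_augU.
by rewrite -!size_eq0 (perm_size mu_nu) subrr.
Qed.

Lemma perm_rel_proper : ~ ideal_gen perm_rel 1.
Proof. exact: (ideal_gen_proper hat_aug_perm). Qed.

(* A^d_q(Lambda) *)
Definition quantum_algebra : Type := quot_alg perm_rel_proper.

HB.instance Definition _ := GRing.Algebra.on quantum_algebra.

Definition quantum_class (x : hat_algebra) : quantum_algebra :=
  quot_pi perm_rel_proper x.

Definition quantum_elt (lam : intpart) : quantum_algebra :=
  quantum_class (hat_elt lam).

Definition eval_q0 : {rmorphism Rq -> rat} := horner_eval (0 : rat).

Lemma specialization_proper :
  ~ ideal_gen (@tensor_rel _ _ eval_q0 quantum_algebra) 1.
Proof.
pose e (u : quantum_algebra) : rat :=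
    eval_q0 (quot_descend (proper := perm_rel_proper) hat_aug u).
have eB : zmod_morphism e.
  by move=> u v; rewrite /e quot_descend_is_additive ?rmorphB //; apply: hat_aug_perm.
have eM : monoid_morphism e.
  have [e1 eM] := quot_descend_is_monoid_morphism perm_rel_proper hat_aug_perm.
  by split=> [|u v]; rewrite /e ?e1 ?rmorph1 // eM rmorphM.
pose h1 := GRing.isZmodMorphism.Build _ _ e eB.
pose h2 := GRing.isMonoidMorphism.Build _ _ e eM.
pose E : {rmorphism quantum_algebra -> rat} := HB.pack e h1 h2.
have eP x : e (quantum_class x) = eval_q0 (hat_aug x).
  by rewrite /e quot_descendE //; apply: hat_aug_perm.
apply: (@tensor_proper _ _ _ _ E) => r; elim/quot_ind=> x.
have -> : r *: quot_pi perm_rel_proper x = quantum_class (r *: x).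
  by rewrite /quantum_class linearZ.
by rewrite -[LHS]/(e _) -[E _]/(e (quantum_class x)) !eP hat_augZ rmorphM.
Qed.

(* A^d_q(Lambda)|_{q = 0} = Q (x)_{Q[q]} A^d_q(Lambda) *)
Definition specialization : Type := base_change specialization_proper.

HB.instance Definition _ := GRing.Algebra.on specialization.

Definition specialization_tensor (c : rat) (u : quantum_algebra) :
  specialization := pure_tensor specialization_proper c u.

End Quantum.

(* Main.v *)
Require Import Defs.
From HB Require Import structures.
From mathcomp Require Import all_boot all_algebra.
From mathcomp Require Import freeg mpoly.

Set Implicit Arguments.
Unset Strict Implicit.
Unset Printing Implicit Defensive.

Import GRing.Theory.
Local Open Scope ring_scope.

(** At q = 0 each factor x_s - q x_t of the structure polynomial becomes x_s,
    so the whole product collapses to the single monomial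
    (x_(m+1) ... x_(m+n))^(m(d-1)) ([structure_poly_q0]).  Hence the product of
    two basis elements mu and nu specializes to one sequence: mu followed by nu
    with every entry increased by m(d-1).  Up to reordering, this is Reineke's
    product ([hat_spec_mul]).

    The isomorphism is therefore obtained by descent.  Evaluating coefficients
    at q = 0 and sorting sequences is a ring morphism [hat_spec] from the free
    module on all sequences to Reineke's algebra; it kills the differences of
    permuted sequences, so it factors through the quantum algebra
    ([quantum_spec]); and since it sends multiplication by a polynomial r to
    multiplication by r(0), it extends to Q (x) - by the universal property of
    base change ([base_change_liftE]).

    In the other direction, Reineke's algebra is free on partitions, so
    lam |-> 1 (x) lam extends linearly.  The two maps are inverse to each other
    because both sides are spanned by partitions: a linear map out of the base
    change is determined by the elements 1 (x) u ([base_change_linP]), u may be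
    taken to be the class of a sequence, and this is the class of its sorting
    ([quantum_class_rearr]). *)

(** * Restriction of scalars *)

Section RestrictScalars.
Context (R : pzRingType) (S : nzRingType) (phi : {rmorphism R -> S}).

(** A semilinear map from an R-module to an S-module M is an R-linear map into
    M with scalars restricted along phi.  This lets semilinear maps be built by
    the universal property of free modules and compared on a basis by
    [freeg_linP].  The new name for the carrier keeps the two scalings apart. *)
Definition restrict_scalars (M : Type) : Type := M.

Section Module.
Context (M : lmodType S).
Local Notation N := (restrict_scalars M).

HB.instance Definition _ := GRing.Zmodule.copy N M.

Definition restrict_scale (r : R) (u : N) : N := phi r *: (u : M).

Lemma restrict_scaleA a b u :
  restrict_scale a (restrict_scale b u) = restrict_scale (a * b) u.
Proof. by rewrite /restrict_scale scalerA rmorphM. Qed.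

Lemma restrict_scale1 : left_id 1 restrict_scale.
Proof. by move=> u; rewrite /restrict_scale rmorph1 scale1r. Qed.

Lemma restrict_scaleDr : right_distributive restrict_scale +%R.
Proof. by move=> a u v; rewrite /restrict_scale scalerDr. Qed.

Lemma restrict_scaleDl u : {morph restrict_scale^~ u : a b / a + b}.
Proof. by move=> a b; rewrite /restrict_scale rmorphD scalerDl. Qed.

Definition restrict_lmod := GRing.Zmodule_isLmodule.Build R N
  restrict_scaleA restrict_scale1 restrict_scaleDr restrict_scaleDl.

Definition restriction : lmodType R := HB.pack N restrict_lmod.

End Module.
End RestrictScalars.

(** * The universal property of base change *)

Section BaseChangeLift.
Context (R : pzRingType) (S : comNzRingType) (phi : {rmorphism R -> S}).
Context (A : algType R) (proper : ~ ideal_gen (@tensor_rel _ _ phi A) 1).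

Local Notation T := (base_change proper).
Local Notation F := (structure_algebra (pair_law S A)).

Lemma pure_tensorE s a :
  pure_tensor proper s a = s *: pure_tensor proper 1 a.
Proof.
have -> : s *: pure_tensor proper 1 a = quot_pi proper (s *: pair_elt 1 a).
  by rewrite linearZ.
apply/quot_piP/ideal_gen_in.
by have := tensor_relZ phi s 1 a; rewrite mulr1.
Qed.

Lemma pure_tensor_semilinear :
  linear (pure_tensor proper 1 : A -> restriction phi T).
Proof.
move=> r a b.
rewrite -[RHS]/(phi r *: pure_tensor proper 1 a + pure_tensor proper 1 b).
rewrite -pure_tensorE -[phi r]mul1r.
have -> : pure_tensor proper (1 * phi r) a = pure_tensor proper 1 (r *: a).
  exact/quot_piP/ideal_gen_in/tensor_relM.
rewrite -[RHS](raddfD (quot_pi proper)).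
exact/quot_piP/ideal_gen_in/tensor_relDr.
Qed.

(** The pairs (s, a) span the base change, and s (x) a = s (1 (x) a). *)
Lemma base_change_linP (M : lmodType S) (f g : T -> M) :
  linear f -> linear g ->
  (forall a, f (pure_tensor proper 1 a) = g (pure_tensor proper 1 a)) -> f =1 g.
Proof.
move=> fL gL fg; elim/quot_ind=> x; move: x.
have [fZ gZ] : scalable f /\ scalable g.
  by split; apply: scalable_linear.
apply: (@freeg_linP _ _ M (f \o quot_pi proper) (g \o quot_pi proper)).
- by move=> c x y /=; rewrite linearP fL.
- by move=> c x y /=; rewrite linearP gL.
move=> [s a] /=; rewrite -[quot_pi _ _]/(pure_tensor proper s a) pure_tensorE.
by rewrite fZ gZ fg.
Qed.

Context (B : algType S) (e : {rmorphism A -> B}).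
Hypothesis e_semi : forall r a, e (r *: a) = phi r *: e a.

(** The map s (x) a |-> s e(a), before passing to the quotient by the tensor
    relations.  It is multiplicative because scalars are central in B. *)
Definition free_lift (x : F) : B := fglift (fun k : S * A => k.1 *: e k.2) x.

Lemma free_liftU s a : free_lift (pair_elt s a) = s *: e a.
Proof. exact: fgliftU1. Qed.

Lemma free_lift_is_linear : linear free_lift.
Proof. by move=> c x y; rewrite /free_lift linearP. Qed.

HB.instance Definition _ :=
  GRing.isLinear.Build S F B *:%R free_lift free_lift_is_linear.

Lemma free_lift_is_monoid_morphism : monoid_morphism free_lift.
Proof.
split; first by rewrite -[1]/(pair_elt 1 1) free_liftU rmorph1 scale1r.
move=> x y; move: x.
apply: (@freeg_linP _ _ B _
  (fun x => free_lift x * free_lift y)) => [c u v|c u v|[s a]].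
- by rewrite mulrDl -scalerAl linearP.
- by rewrite linearP mulrDl -scalerAl.
rewrite -[<< _ >>]/(pair_elt s a : F) free_liftU; move: y.
apply: (@freeg_linP _ _ B _
  (fun y => (s *: e a) * free_lift y)) => [c u v|c u v|[t b]].
- by rewrite mulrDr -scalerAr linearP.
- by rewrite linearP mulrDr -scalerAr.
rewrite -[<< _ >>]/(pair_elt t b : F) free_liftU.
rewrite [_ * _ in LHS]sa_mulUU -[sl_mul _ _ _]/(pair_elt _ _) free_liftU /=.
by rewrite rmorphM -scalerAl -scalerAr scalerA.
Qed.

HB.instance Definition _ :=
  GRing.isMonoidMorphism.Build F B free_lift free_lift_is_monoid_morphism.

Lemma free_lift_rel x : tensor_rel phi x -> free_lift x = 0.
Proof.
case=> [s1 s2 a|s a1 a2|s r a|s1 s2 a]; rewrite raddfB /=.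
- by rewrite raddfD /= !free_liftU scalerDl subrr.
- by rewrite raddfD /= !free_liftU rmorphD scalerDr subrr.
- by rewrite !free_liftU e_semi scalerA subrr.
- by rewrite linearZ /= !free_liftU scalerA subrr.
Qed.

Definition base_change_lift (u : T) : B :=
  quot_descend (proper := proper) free_lift u.

Lemma base_change_liftE s a :
  base_change_lift (pure_tensor proper s a) = s *: e a.
Proof.
rewrite /base_change_lift quot_descendE; last exact: free_lift_rel.
exact: free_liftU.
Qed.

Lemma base_change_lift_is_linear : linear base_change_lift.
Proof.
move=> c; elim/quot_ind=> x; elim/quot_ind=> y.
have liftE z : base_change_lift (quot_pi proper z) = free_lift z.
  by apply: quot_descendE; exact: free_lift_rel.
apply: etrans (_ : base_change_lift (quot_pi proper (c *: x + y)) = _).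
  by rewrite linearP.
by rewrite !liftE linearP.
Qed.

HB.instance Definition _ :=
  GRing.isLinear.Build S T B *:%R base_change_lift base_change_lift_is_linear.
HB.instance Definition _ :=
  GRing.isMonoidMorphism.Build T B base_change_lift
    (quot_descend_is_monoid_morphism proper free_lift_rel).

Definition base_change_lrmorphism : {lrmorphism T -> B} := base_change_lift.

End BaseChangeLift.

(** * The structure polynomial at q = 0 *)

(** Each x_(m+s) occurs in m factors, one for each t, all with exponent
    d - 1. *)
Lemma structure_poly_q0 d m n :
  map_mpoly eval_q0 (structure_poly d m n) =
  'X_[[multinom of nseq m 0%N ++ nseq n (m * d.-1)%N]].
Proof.
rewrite rmorph_prod [RHS]mpolyXE_id big_split_ord /=.
rewrite [X in _ = X * _]big1 ?mul1r => [|i _]; last first.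
  by rewrite multinomE tnth_lshift (tnth_nth 0%N) nth_nseq if_same expr0.
apply: eq_bigr => s _.
rewrite multinomE tnth_rshift (tnth_nth 0%N) nth_nseq ltn_ord.
rewrite rmorph_prod (eq_bigr (fun=> 'X_(rshift m s) ^+ d.-1)) => [|t _].
  by rewrite prodr_const card_ord -exprM mulnC.
rewrite rmorphXn rmorphB /= map_mpolyZ !map_mpolyX.
by rewrite /eval_q0 /= /horner_eval hornerX scale0r subr0.
Qed.

(** * The isomorphism *)

Section Isomorphism.
Variable d : nat.

Local Notation Rq := {poly rat}.
Local Notation A := (reineke_algebra d).
Local Notation A0 := (restriction eval_q0 A).

Definition hat_spec (x : hat_algebra d) : A :=
  fglift (fun mu => reineke_elt d (rearr mu) : A0) x.

Lemma hat_specU mu : hat_spec (hat_elt d mu) = reineke_elt d (rearr mu).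
Proof. exact: (@fgliftU1 _ _ A0). Qed.

Lemma hat_spec_semilinear : linear (hat_spec : _ -> A0).
Proof. by move=> c x y; rewrite /hat_spec linearP. Qed.

Lemma hat_specB : zmod_morphism hat_spec.
Proof. by move=> x y; rewrite /hat_spec raddfB. Qed.

HB.instance Definition _ :=
  GRing.isZmodMorphism.Build (hat_algebra d) A hat_spec hat_specB.

Lemma hat_specZ c x : hat_spec (c *: x) = eval_q0 c *: hat_spec x.
Proof. exact: (scalable_linear hat_spec_semilinear). Qed.

(** Specializing a product x^s p only requires specializing the coefficients of
    p, so [structure_poly_q0] can be applied before expanding into
    monomials. *)
Lemma hat_spec_mul_monom n s (p : {mpoly Rq[n]}) :
  hat_spec (mul_monom s p) =
  fglift (reineke_elt d \o rearr) (mul_monom s (map_mpoly eval_q0 p)).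
Proof.
rewrite [in RHS](mpolyE p) (raddf_sum (map_mpoly _)).
rewrite (linear_sum (@mul_monom rat n s)) !raddf_sum; apply: eq_bigr => k _ /=.
rewrite map_mpolyZ map_mpolyX /= hat_specZ !linearZ /= mul_monomX fgliftU1.
by rewrite -[<< _ >>]/(hat_elt d _) hat_specU.
Qed.

Lemma hat_spec_mul mu nu :
  hat_spec (hat_mul d mu nu) = reineke_elt d (reineke_op d (rearr mu) (rearr nu)).
Proof.
rewrite (@hat_mulE d (size mu) (size nu)) // hat_spec_mul_monom.
rewrite structure_poly_q0 mul_monomX fgliftU1 /=; congr reineke_elt.
rewrite addseq_cat ?size_nseq // addseq0; apply: rearr_perm.
have -> : addseq nu (nseq (size nu) (size mu * d.-1)) =
    reineke_shift d (size mu) nu.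
  elim: nu (size mu * d.-1)%N => // x s IHs k.
  by rewrite /addseq /=; congr cons; apply: IHs.
rewrite /= size_sort perm_sym; apply: perm_cat; first by rewrite perm_sort.
by apply: perm_map; rewrite perm_sort.
Qed.

(** Both sides of the product rule are semilinear in x and in y, which reduces
    the claim to basis elements, where it is [hat_spec_mul]. *)
Lemma hat_spec_is_monoid_morphism : monoid_morphism hat_spec.
Proof.
split=> [|x y]; first by rewrite -[1]/(hat_elt d [::]) hat_specU.
have addZ c u v : hat_spec (c *: u + v) = eval_q0 c *: hat_spec u + hat_spec v.
  exact: hat_spec_semilinear.
move: x; apply: (@freeg_linP _ _ A0 _
  (fun x => hat_spec x * hat_spec y)).
- by move=> c u v; rewrite mulrDl -scalerAl addZ.
- by move=> c u v; rewrite addZ mulrDl -scalerAl.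
move=> mu; rewrite -[<< mu >>]/(hat_elt d mu); move: y.
apply: (@freeg_linP _ _ A0 _
  (fun y => hat_spec (hat_elt d mu) * hat_spec y)).
- by move=> c u v; rewrite mulrDr -scalerAr addZ.
- by move=> c u v; rewrite addZ mulrDr -scalerAr.
move=> nu; rewrite -[<< nu >>]/(hat_elt d nu) !hat_specU.
rewrite [_ * _ in LHS]sa_mulUU [RHS]sa_mulUU.
exact: hat_spec_mul.
Qed.

HB.instance Definition _ :=
  GRing.isMonoidMorphism.Build (hat_algebra d) A hat_spec
    hat_spec_is_monoid_morphism.

Lemma hat_spec_perm x : perm_rel x -> hat_spec x = 0.
Proof.
by case=> mu nu mu_nu; rewrite rmorphB /= !hat_specU (rearr_perm mu_nu) subrr.
Qed.

Definition quantum_spec (u : quantum_algebra d) : A :=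
  quot_descend (proper := @perm_rel_proper d) hat_spec u.

HB.instance Definition _ :=
  GRing.isZmodMorphism.Build (quantum_algebra d) A quantum_spec
    (@quot_descend_is_additive _ _ _ (@perm_rel_proper d) _ _ hat_spec_perm).
HB.instance Definition _ :=
  GRing.isMonoidMorphism.Build (quantum_algebra d) A quantum_spec
    (quot_descend_is_monoid_morphism (@perm_rel_proper d) hat_spec_perm).

Lemma quantum_specE x : quantum_spec (quantum_class x) = hat_spec x.
Proof. by apply: quot_descendE; apply: hat_spec_perm. Qed.

Lemma quantum_specZ c u : quantum_spec (c *: u) = eval_q0 c *: quantum_spec u.
Proof.
elim/quot_ind: u => x; rewrite -[quot_pi _ x]/(quantum_class x).
have <- : quantum_class (c *: x) = c *: quantum_class x.
  by rewrite /quantum_class linearZ.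
by rewrite !quantum_specE hat_specZ.
Qed.

Definition specialize : {lrmorphism specialization d -> A} :=
  base_change_lrmorphism (@specialization_proper d) quantum_specZ.

Lemma specialize_is_linear : linear specialize.
Proof. exact: linearP. Qed.

Lemma specializeU lam :
  specialize (specialization_tensor 1 (quantum_elt d lam)) = reineke_elt d lam.
Proof.
rewrite [LHS](base_change_liftE _ quantum_specZ) scale1r.
by rewrite /= quantum_specE hat_specU rearr_id.
Qed.

Definition unspecialize (x : A) : specialization d :=
  fglift (fun lam => specialization_tensor 1 (quantum_elt d lam)) x.

Lemma unspecialize_is_linear : linear unspecialize.
Proof. by move=> c x y; rewrite /unspecialize linearP. Qed.

Lemma unspecializeU lam :
  unspecialize (reineke_elt d lam) = specialization_tensor 1 (quantum_elt d lam).
Proof. exact: fgliftU1. Qed.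

Lemma unspecializeK : cancel unspecialize specialize.
Proof.
apply: (@freeg_linP _ _ A (specialize \o unspecialize) id) => // [c x y|lam];
  rewrite /comp.
  by rewrite unspecialize_is_linear specialize_is_linear.
by rewrite -[<< lam >>]/(reineke_elt d lam) unspecializeU specializeU.
Qed.

Lemma quantum_class_rearr mu :
  quantum_class (hat_elt d mu) = quantum_elt d (rearr mu).
Proof.
apply/quot_piP/ideal_gen_in/perm_rel_in.
by rewrite perm_sym perm_sort.
Qed.

(** By [base_change_linP] only the elements 1 (x) u matter; as 1 (x) u is
    semilinear in u, it is then enough to let u be the class of a sequence. *)
Lemma specializeK : cancel specialize unspecialize.
Proof.
apply: (@base_change_linP _ _ _ _ _ _ (unspecialize \o specialize) id) => //.
  by move=> c x y; rewrite /comp specialize_is_linear unspecialize_is_linear.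
elim/quot_ind=> x; rewrite -[quot_pi _ x]/(quantum_class x); move: x.
pose t x : specialization d :=
  specialization_tensor 1 (quantum_class (x : hat_algebra d)).
have tP c x y : t (c *: x + y) = eval_q0 c *: t x + t y.
  rewrite /t /quantum_class linearP; exact: pure_tensor_semilinear.
apply: (@freeg_linP _ _ (restriction eval_q0 (specialization d))
  (unspecialize \o specialize \o t) t) => [c x y|c x y|mu]; rewrite /comp.
- by rewrite tP specialize_is_linear unspecialize_is_linear.
- by rewrite tP.
rewrite /t -[<< mu >>]/(hat_elt d mu) quantum_class_rearr.
by rewrite specializeU unspecializeU.
Qed.

End Isomorphism.

Theorem corollary3p7 (d : nat) (d_gt0 : (0 < d)%N) :
  exists f : {lrmorphism specialization d -> reineke_algebra d},
    bijective f /\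
    forall lam : intpart,
      f (specialization_tensor 1 (quantum_elt d lam)) = reineke_elt d lam.
Proof.
exists (@specialize d); split; last exact: specializeU.
by exists (@unspecialize d); [exact: specializeK | exact: unspecializeK].
Qed.
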